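(* There is a deterministic algorithm which, given as input a directed graph $G$ on $n$ vertices (with no loops or multiple arcs), two vertices $s,t$ of $G$, and a path decomposition $P=\{P_1,\dots,P_k\}$ of $G$ consisting of $k$ directed paths (each path given as its sequence of vertices), decides whether there is a directed path from $s$ to $t$ in $G$, and which simultaneously uses $O(k\log n)$ space and runs in time polynomial in $n$.
   Context: A path decomposition of a directed graph $G$ (with no loops or multiple arcs) is a family of simple directed paths such that every edge of $G$ lies on exactly one path of the family; equivalently, a partition of the edge set of $G$ into edge-disjoint directed paths. Space is measured as the working space of a machine with read-only access to the input (the input does not count toward the space bound). *)

(* Defs.v *)
From mathcomp Require Import all_boot.

Set Implicit Arguments.
Unset Strict Implicit.
Unset Printing Implicit Defensive.

(** Random access machine with a read-only input and a read-write memory, both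
    sequences of natural numbers. Operands [r], [a], [b] are addresses of memory
    cells, [l] is a program address. *)
Inductive instr : Type :=
| IConst (r v : nat)     (* M[r] := v *)
| ICopy (r a : nat)      (* M[r] := M[a] *)
| IAdd (r a b : nat)     (* M[r] := M[a] + M[b] *)
| ISub (r a b : nat)     (* M[r] := M[a] - M[b], truncated at 0 *)
| ILoad (r a : nat)      (* M[r] := M[M[a]] *)
| IStore (a b : nat)     (* M[M[a]] := M[b] *)
| IRead (r a : nat)      (* M[r] := input[M[a]] *)
| IJump (l : nat)
| IJumpZ (a l : nat)     (* jump to l if M[a] = 0 *)
| IHalt (answer : bool).

Definition program := seq instr.

Record config : Type := Config { pc : nat; mem : seq nat }.

Definition init : config := Config 0 [::].

(** Leaving the program is rejection. *)
Definition fetch (prog : program) (c : config) : instr :=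
  nth (IHalt false) prog (pc c).

Definition step (prog : program) (input : seq nat) (c : config) : config :=
  let M := mem c in
  let get a := nth 0 M a in
  let put r v := Config (pc c).+1 (set_nth 0 M r v) in
  match fetch prog c with
  | IConst r v => put r v
  | ICopy r a => put r (get a)
  | IAdd r a b => put r (get a + get b)
  | ISub r a b => put r (get a - get b)
  | ILoad r a => put r (get (get a))
  | IStore a b => put (get a) (get b)
  | IRead r a => put r (nth 0 input (get a))
  | IJump l => Config l M
  | IJumpZ a l => Config (if get a == 0 then l else (pc c).+1) M
  | IHalt _ => c
  end.

Definition run (prog : program) (input : seq nat) (i : nat) : config :=
  iter i (step prog input) init.

(** The length of the binary representation of [v], with [bitlen 0 = 1]. *)
Definition bitlen (v : nat) : nat := (trunc_log 2 v).+1.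

(** Working space in bits. Writing to a cell allocates every cell below it
    ([set_nth] pads with zeros) and each allocated cell costs at least one bit,
    so a sparse use of large addresses is charged in full. *)
Definition space (M : seq nat) : nat := \sum_(v <- M) bitlen v.

(** On [input], [prog] halts with [answer] after at most [T] instructions, no
    configuration of the computation using more than [S] bits. Time is the number
    of instructions: each of them takes time polynomial in [S] and in the size of
    the input when carried out bit by bit. *)
Definition decides_within (prog : program) (input : seq nat) (answer : bool)
    (T S : nat) : Prop :=
  exists i : nat,
    [/\ i <= T,
        fetch prog (run prog input i) = IHalt answer
      & forall j : nat, j <= i -> space (mem (run prog input j)) <= S].

Section Digraph.
Variables (n : nat) (e : rel 'I_n).

Definition simple_dipath (p : seq 'I_n) : bool :=
  if p is x :: q then path e x q && uniq p else false.

Definition arcs (p : seq 'I_n) : seq ('I_n * 'I_n) := zip p (behead p).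

(** The family is a set of paths, whence [uniq P]; this only matters for paths
    without arcs, since the second condition excludes any other repetition. *)
Definition path_decomposition (P : seq (seq 'I_n)) : Prop :=
  [/\ uniq P,
      all simple_dipath P
    & forall u v : 'I_n, e u v -> count (fun p => (u, v) \in arcs p) P = 1].

(** n, s, t, k, the adjacency matrix by rows, then each path as its number of
    vertices followed by the vertices. *)
Definition encode (s t : 'I_n) (P : seq (seq 'I_n)) : seq nat :=
  [:: n; val s; val t; size P]
  ++ [seq nat_of_bool (e u v) | u <- enum 'I_n, v <- enum 'I_n]
  ++ flatten [seq size p :: map val p | p <- P].

End Digraph.

(** k log n, with both factors replaced by 1 when they vanish (k = 0, n = 1). *)
Definition klogn (k n : nat) : nat := maxn 1 k * maxn 1 (trunc_log 2 n).

(* Main.v *)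
(** For each path of the decomposition, store how many of its last vertices are
    known to be reachable from [s]: if a vertex of a path is reachable, so are
    all later ones, so one number at most [n] describes the known part of a
    path, and k numbers describe a set of reachable vertices. A vertex is known
    if it is [s] or lies in the stored suffix of some path; relaxing a known
    vertex extends the stored suffixes of all the paths through it. Every arc
    joins consecutive vertices of some path, so relaxing all the vertices [n]
    times makes known every vertex reachable from [s]. Distinct paths have
    distinct first arcs, hence k <= n^2 and both the values in memory and the
    running time are polynomial in [n]. *)

Require Import Defs.
From mathcomp Require Import all_boot.
From mathcomp Require Import zify.

Set Implicit Arguments.
Unset Strict Implicit.
Unset Printing Implicit Defensive.

(** * Contiguous blocks in a sequence, for code in a program and for path data in the input *)

Definition segment (T : Type) (s : seq T) (off : nat) (l : seq T) : Prop :=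
  exists s1 s2, s = s1 ++ l ++ s2 /\ size s1 = off.

Lemma segment_cat (T : Type) (s : seq T) off l1 l2 :
  segment s off (l1 ++ l2) -> segment s off l1 /\ segment s (off + size l1) l2.
Proof.
move=> [s1 [s2 [-> <-]]]; split; first by exists s1, (l2 ++ s2); rewrite -!catA.
by exists (s1 ++ l1), s2; rewrite size_cat -!catA.
Qed.

Lemma segment_cons (T : Type) (x0 : T) (s : seq T) off x l :
  segment s off (x :: l) -> nth x0 s off = x /\ segment s off.+1 l.
Proof.
rewrite -cat1s => /segment_cat[[s1 [s2 [-> <-]]]]; rewrite addn1 => h.
by split=> //; rewrite nth_cat ltnn subnn.
Qed.

Lemma segment_size (T : Type) (s : seq T) off l :
  segment s off l -> off + size l <= size s.
Proof. by move=> [s1 [s2 [-> <-]]]; rewrite !size_cat; lia. Qed.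

(** * A structured language compiled to the machine *)

Inductive cmd : Type :=
| Block (b : seq instr)
| Seq (c1 c2 : cmd)
| While (a : nat) (c : cmd)
| If (a : nat) (c1 c2 : cmd).

Fixpoint clen (c : cmd) : nat :=
  match c with
  | Block b => size b
  | Seq c1 c2 => clen c1 + clen c2
  | While _ c => (clen c).+2
  | If _ c1 c2 => (clen c1 + clen c2).+2
  end.

(** Jump targets are absolute, hence the load address [off]; code length does not depend on it, so
    [clen] gives the targets in advance. *)
Fixpoint compile (off : nat) (c : cmd) : program :=
  match c with
  | Block b => b
  | Seq c1 c2 => compile off c1 ++ compile (off + clen c1) c2
  | While a c =>
      IJumpZ a (off + (clen c).+2) :: compile off.+1 c ++ [:: IJump off]
  | If a c1 c2 =>
      IJumpZ a (off + (clen c1).+2) :: compile off.+1 c1 ++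
      IJump (off + (clen c1 + clen c2).+2) :: compile (off + (clen c1).+2) c2
  end.

Lemma size_compile off c : size (compile off c) = clen c.
Proof.
elim: c off => [b|c1 h1 c2 h2|a c h|a c1 h1 c2 h2] off //=;
  by rewrite !size_cat /= ?h ?h1 ?h2; lia.
Qed.

(** * Execution rules with simultaneous time and space bounds *)

Section Execution.
Variables (input : seq nat) (lim V : nat).

(* The invariant of all memories, from which the space bound follows. *)
Definition tame (m : seq nat) : bool :=
  (size m <= lim) && all (fun v => v <= V) m.

Lemma tame_nth m i : tame m -> nth 0 m i <= V.
Proof.
move=> /andP[_ /allP h]; have [hi|hi] := ltnP i (size m).
  exact: h (mem_nth 0 hi).
by rewrite nth_default.
Qed.

Lemma tame_set_nth m r v :
  tame m -> r < lim -> v <= V -> tame (set_nth 0 m r v).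
Proof.
move=> hm hr hv; have /andP[hs _] := hm; rewrite /tame size_set_nth geq_max hr hs /=.
apply/(all_nthP 0) => i _; rewrite nth_set_nth /=; case: eqP => // _.
exact: tame_nth.
Qed.

Lemma tame_space m : tame m -> space m <= lim * bitlen V.
Proof.
move=> /andP[hs /allP ha]; rewrite /space.
apply: (@leq_trans (\sum_(v <- m) bitlen V)).
  rewrite [leqLHS]big_seq [leqRHS]big_seq.
  by apply: leq_sum => v /ha hv; rewrite /bitlen ltnS leq_trunc_log.
by rewrite big_const_seq count_predT iter_addn_0 mulnC leq_mul2r hs orbT.
Qed.

Section Reaches.
Variable prog : program.

(** Every intermediate memory has to be [tame], because space is charged throughout; [t] is only an
    upper bound, so that branches of different cost can share it. *)
Definition reaches (t : nat) (c c' : config) : Prop :=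
  exists i, [/\ i <= t, iter i (step prog input) c = c'
    & forall j, j <= i -> tame (Defs.mem (iter j (step prog input) c))].

Lemma reaches_refl c : tame (Defs.mem c) -> reaches 0 c c.
Proof. by move=> hc; exists 0; split=> // j; case: j. Qed.

Lemma reaches_tame t c c' : reaches t c c' -> tame (Defs.mem c').
Proof. by move=> [i [_ <- h]]; exact: h. Qed.

Lemma reaches_trans t1 t2 c1 c2 c3 :
  reaches t1 c1 c2 -> reaches t2 c2 c3 -> reaches (t1 + t2) c1 c3.
Proof.
move=> [i1 [l1 e1 h1]] [i2 [l2 e2 h2]]; exists (i2 + i1); split.
- by lia.
- by rewrite iterD e1.
move=> j hj; have [hji|hji] := leqP j i1; first exact: h1.
by rewrite -(subnK (ltnW hji)) iterD e1; apply: h2; lia.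
Qed.

Lemma reaches_step c c' :
  tame (Defs.mem c) -> tame (Defs.mem c') -> step prog input c = c' -> reaches 1 c c'.
Proof. by move=> h h' e; exists 1; split=> // -[|[|//]] _ //=; rewrite e. Qed.

Lemma reaches_leq t t' c c' : t <= t' -> reaches t c c' -> reaches t' c c'.
Proof.
by move=> htt [i [hi e h]]; exists i; split=> //; apply: leq_trans htt.
Qed.

End Reaches.

(** A total-correctness triple, valid wherever the code is placed in whatever program; this is what
    lets triples compose. *)
Definition runs (c : cmd) (m : seq nat) (t : nat) (m' : seq nat) : Prop :=
  forall prog off, segment prog off (compile off c) ->
  tame m -> reaches prog t (Config off m) (Config (off + clen c) m').

Lemma runs_leq t t' c m m' : runs c m t m' -> t <= t' -> runs c m t' m'.
Proof. by move=> h htt prog off hc hm; apply: reaches_leq (h _ _ hc hm). Qed.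

Definition write (i : instr) (m : seq nat) : option (nat * nat) :=
  let get a := nth 0 m a in
  match i with
  | IConst r v => Some (r, v)
  | ICopy r a => Some (r, get a)
  | IAdd r a b => Some (r, get a + get b)
  | ISub r a b => Some (r, get a - get b)
  | ILoad r a => Some (r, get (get a))
  | IStore a b => Some (get a, get b)
  | IRead r a => Some (r, nth 0 input (get a))
  | _ => None
  end.

Definition perform (m : seq nat) (i : instr) : seq nat :=
  if write i m is Some (r, v) then set_nth 0 m r v else m.

Fixpoint block_ok (b : seq instr) (m : seq nat) : Prop :=
  if b is i :: b' then
    (if write i m is Some (r, v) then r < lim /\ v <= V else False)
    /\ block_ok b' (perform m i)
  else True.

(** On a concrete block the side condition computes to arithmetic goals; assuming [tame m] there
    makes the bound [V] on stored values available. *)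
Lemma runs_block b m :
  (tame m -> block_ok b m) -> runs (Block b) m (size b) (foldl perform m b).
Proof.
move=> hb prog off /= hs hm; move: (hb hm) => {}hb.
elim: b off m hb hs hm => [|i b IH] off m /=.
  by move=> _ _ hm; rewrite addn0; apply: reaches_refl.
case=> hi hb /(segment_cons (IHalt false))[ei hs] hm.
have hm' : tame (perform m i).
  by rewrite /perform; case: write hi => // -[r v] [hr hv]; apply: tame_set_nth.
rewrite -add1n addnA addn1; apply: reaches_trans (IH _ _ hb hs hm').
apply: reaches_step => //.
by rewrite /step /fetch /= ei /perform; case: i hi {ei hb hm'}.
Qed.

Lemma runs_seq c1 c2 m1 m2 m3 t1 t2 :
  runs c1 m1 t1 m2 -> runs c2 m2 t2 m3 -> runs (Seq c1 c2) m1 (t1 + t2) m3.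
Proof.
move=> h1 h2 prog off /= /segment_cat[s1]; rewrite size_compile => s2 hm.
have r1 := h1 _ _ s1 hm.
by rewrite addnA; apply: reaches_trans r1 (h2 _ _ s2 (reaches_tame r1)).
Qed.

Lemma runs_while0 a c m : nth 0 m a = 0 -> runs (While a c) m 1 m.
Proof.
move=> ha prog off /= /(segment_cons (IHalt false))[e _] hm.
by apply: reaches_step => //; rewrite /step /fetch /= e ha.
Qed.

Lemma runs_whileS a c m1 m2 m3 t1 t2 :
  0 < nth 0 m1 a -> runs c m1 t1 m2 -> runs (While a c) m2 t2 m3 ->
  runs (While a c) m1 (t1 + t2 + 2) m3.
Proof.
move=> ha h1 h2 prog off hs hm; move: (hs).
move=> /= /(segment_cons (IHalt false))[e /segment_cat[s1]].
rewrite size_compile.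
move=> /(segment_cons (IHalt false))[e2 _].
have r1 := h1 _ _ s1 hm; have hm2 : tame m2 := reaches_tame r1.
apply: (@reaches_leq _ (1 + (t1 + (1 + t2)))); first by lia.
apply: (reaches_trans (c2 := Config off.+1 m1)).
  apply: reaches_step => //.
  by rewrite /step /fetch /= e; case: eqP ha => [->|].
apply: reaches_trans r1 _.
apply: reaches_trans (h2 _ _ hs hm2).
by apply: reaches_step; rewrite // /step /fetch /= e2.
Qed.

Lemma runs_if a c1 c2 m m' t :
  runs (if nth 0 m a == 0 then c2 else c1) m t m' ->
  runs (If a c1 c2) m (t + 2) m'.
Proof.
move=> h prog off /= /(segment_cons (IHalt false))[e /segment_cat[s1]].
rewrite size_compile.
move=> /(segment_cons (IHalt false))[e2 s2] hm.
have st : step prog input (Config off m) =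
    Config (if nth 0 m a == 0 then off + (clen c1).+2 else off.+1) m.
  by rewrite /step /fetch /= e; case: ifP.
case: ifP h st => _ h st.
  apply: (@reaches_leq _ (1 + t)); first by lia.
  have := h prog (off + (clen c1).+2); rewrite -addnA addSn addSn.
  move=> {}h; apply: (reaches_trans (c2 := Config (off + (clen c1).+2) m)).
    exact: reaches_step.
  by apply: h => //; move: s2; congr segment; lia.
apply: (@reaches_leq _ (1 + (t + 1))); first by lia.
apply: (reaches_trans (c2 := Config off.+1 m)); first exact: reaches_step.
have r1 := h _ _ s1 hm; have hm2 : tame m' := reaches_tame r1.
apply: reaches_trans r1 _.
by apply: reaches_step; rewrite // /step /fetch /= e2.
Qed.

End Execution.

(** * Stored suffixes and the effect of one scan *)

(* The number of vertices of [l] from [v] on; [0] if [v] is not in [l]. *)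
Definition rest (v : nat) (l : seq nat) : nat := size l - index v l.

Lemma rest_cons v u l :
  rest v (u :: l) = if u == v then (size l).+1 else rest v l.
Proof. by rewrite /rest /=; case: eqP. Qed.

Lemma rest_notin v l : v \notin l -> rest v l = 0.
Proof. by move=> /memNindex h; rewrite /rest h subnn. Qed.

(** [0 < rest v l <= c] encodes that [v] is among the last [c] vertices of [l]. The flag may be
    raised midway, so in general a suffix is only bounded on both sides; all are surely extended
    when the flag is set from the start. *)
Definition scanned (v : nat) (ps : seq (seq nat)) (f : bool) (g : nat -> nat)
    (f' : bool) (g' : nat -> nat) : Prop :=
  [/\ f' <-> f \/ exists i, 0 < rest v (nth [::] ps i) <= g i,
      forall i, g i <= g' i <= maxn (g i) (rest v (nth [::] ps i)),
      f -> forall i, rest v (nth [::] ps i) <= g' i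
    & ~~ f' -> forall i, g' i = g i].

(** * The program *)

(* Registers: [rBase] holds the input address of the first path, [rA] the input
   address being read, [rP] the address of the memory cell of the current path,
   [rJ] the number of paths and [rM] the number of vertices of the current path
   still to be scanned. The cells of the paths follow the registers, from
   address 15 on, and are read as 0 before they are first written. *)
Local Notation rN := 0 (only parsing).
Local Notation rS := 1 (only parsing).
Local Notation rT := 2 (only parsing).
Local Notation rK := 3 (only parsing).
Local Notation rBase := 4 (only parsing).
Local Notation rOne := 5 (only parsing).
Local Notation rRound := 6 (only parsing).
Local Notation rV := 7 (only parsing).
Local Notation rF := 8 (only parsing).
Local Notation rA := 9 (only parsing).
Local Notation rP := 10 (only parsing).
Local Notation rJ := 11 (only parsing).
Local Notation rM := 12 (only parsing).
Local Notation rX := 13 (only parsing).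
Local Notation rY := 14 (only parsing).

(* When the vertex being read is [rV]: if it lies in the stored suffix of its path
   then set [rF], otherwise, provided [rF] is set, extend the suffix to it. *)
Definition visit : cmd :=
  Seq (Block [:: IRead rX rA; ISub rY rX rV; ISub rX rV rX; IAdd rX rX rY])
  (Seq (If rX (Block [::])
         (Seq (Block [:: ILoad rX rP; ISub rY rM rX])
              (If rY (If rF (Block [:: IStore rP rM]) (Block [::]))
                     (Block [:: IConst rF 1]))))
       (Block [:: IAdd rA rA rOne; ISub rM rM rOne])).

Definition scan_path : cmd :=
  Seq (Block [:: IRead rM rA; IAdd rA rA rOne])
  (Seq (While rM visit)
       (Block [:: IAdd rP rP rOne; ISub rJ rJ rOne])).

Definition scan : cmd :=
  Seq (Block [:: ICopy rA rBase; IConst rP 15; ICopy rJ rK])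
      (While rJ scan_path).

(** The two truncated differences add up to the distance of [rV] and [rS], so [rF] starts as 1
    exactly when the vertex is the source. *)
Definition query : cmd :=
  Seq (Block [:: ISub rX rV rS; ISub rY rS rV; IAdd rX rX rY; ISub rF rOne rX])
      scan.

(* [query] may set [rF] after having passed some of the paths through [rV], hence
   a second scan. *)
Definition relax : cmd :=
  Seq (Block [:: ISub rV rV rOne]) (Seq query scan).

Definition round : cmd :=
  Seq (Block [:: ICopy rV rN])
  (Seq (While rV relax) (Block [:: ISub rRound rRound rOne])).

(* The first instruction writes to the last register and thereby allocates all
   of them. *)
Definition prologue : seq instr :=
  [:: IConst rY 0; IRead rN rY; IConst rOne 1; IRead rS rOne; IConst rX 2;
      IRead rT rX; IConst rX 3; IRead rK rX; IConst rBase 4; ICopy rRound rN].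

(** Multiplication is not an instruction: the address [4 + n * n] of the path data is obtained by
    adding [n] once per matrix row. *)
Definition skip_row : cmd :=
  Block [:: IAdd rBase rBase rN; ISub rRound rRound rOne].

Definition decide : cmd :=
  Seq (Block prologue)
  (Seq (While rRound skip_row)
  (Seq (Block [:: ICopy rRound rN])
  (Seq (While rRound round)
  (Seq (Block [:: ICopy rV rT]) query)))).

Definition reach_program : program :=
  compile 0 decide ++
  [:: IJumpZ rF (clen decide).+2; IHalt true; IHalt false].

(** * Effect and cost of each routine on a fixed input *)

Section Reach.
Variables (input : seq nat) (n s t k V : nat) (Q : seq (seq nat)).

Let b := 4 + n * n.
Let path_at i := nth [::] Q i.

Hypothesis (size_Q : size Q = k).
Hypothesis (input_header :
  [/\ nth 0 input 0 = n, nth 0 input 1 = s, nth 0 input 2 = t & nth 0 input 3 = k]).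
Hypothesis (input_paths : segment input b (flatten [seq size l :: l | l <- Q])).
Hypothesis (good_paths :
  forall l : seq nat, l \in Q -> [/\ uniq l, size l <= n & all (fun u => u < n) l]).
Hypothesis (lt_sn : s < n) (lt_tn : t < n).
Hypothesis (le_V : size input <= V) (le_nV : n <= V) (le_kV : 15 + k <= V).

Local Notation runs := (runs input (15 + k) V).

Definition memory r v f a p j m x y (A : seq nat) : seq nat :=
  [:: n; s; t; k; b; 1; r; v; f; a; p; j; m; x; y] ++ A.

Local Notation cell A i := (nth 0 A i).

(** The counter [m.+1] is the number of vertices from the one being read to the end of its path. On
    a hit, [m < cell A o] thus means membership in the stored suffix, and storing [m.+1] extends the
    suffix to that vertex. The storing branch is the longest and costs 15. *)
Lemma run_visit r v (f : bool) a o j m x0 y0 A :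
  v < n -> nth 0 input a < n -> a < V -> m < V -> o < k ->
  let hit := nth 0 input a == v in
  exists x y A',
  [/\ runs visit (memory r v f a (15 + o) j m.+1 x0 y0 A) 15
        (memory r v (f || hit && (m < cell A o)) a.+1 (15 + o) j m x y A')
    & forall i, cell A' i =
        if [&& i == o, f & hit] then maxn (cell A o) m.+1 else cell A i].
Proof.
move=> hv hu ha hm ho; set u := nth 0 input a => hit.
pose x := (v - u) + (u - v).
have h1 : runs (Block [:: IRead rX rA; ISub rY rX rV; ISub rX rV rX; IAdd rX rX rY])
    (memory r v f a (15 + o) j m.+1 x0 y0 A) 4
    (memory r v f a (15 + o) j m.+1 x (u - v) A).
  apply: runs_block => /=; rewrite -/u; lia.
have h3 (f' : bool) x' y' A' :
    runs (Block [:: IAdd rA rA rOne; ISub rM rM rOne])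
    (memory r v f' a (15 + o) j m.+1 x' y' A') 2
    (memory r v f' a.+1 (15 + o) j m x' y' A').
  have := @runs_block input (15 + k) V
    [:: IAdd rA rA rOne; ISub rM rM rOne] (memory r v f' a (15 + o) j m.+1 x' y' A').
  rewrite /= /perform /= addn1 subn1; apply; lia.
have x0E : (x == 0) = hit by rewrite /hit /x; lia.
have [hitE|hitE] := boolP hit; last first.
  exists x, (u - v), A; split; last by move=> i; rewrite !andbF.
  rewrite orbF; apply: (runs_leq (t := 4 + (0 + 2 + 2))); last by [].
  apply: runs_seq h1 (runs_seq (runs_if _) (h3 _ _ _ _)).
  by rewrite /= x0E (negbTE hitE); apply: runs_block.
pose c := cell A o.
have h2 : runs (Block [:: ILoad rX rP; ISub rY rM rX])
    (memory r v f a (15 + o) j m.+1 x (u - v) A) 2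
    (memory r v f a (15 + o) j m.+1 c (m.+1 - c) A).
  apply: runs_block => /tame_nth -/(_ (15 + o)); rewrite -[nth _ _ _]/c => hc.
  rewrite /= !addSn add0n /= -/c; lia.
pose A' := set_nth 0 A o m.+1.
have h4 : runs (Block [:: IStore rP rM])
    (memory r v f a (15 + o) j m.+1 c (m.+1 - c) A) 1
    (memory r v f a (15 + o) j m.+1 c (m.+1 - c) A').
  by apply: runs_block => /=; split=> //; lia.
have h5 : runs (Block [:: IConst rF 1])
    (memory r v f a (15 + o) j m.+1 c (m.+1 - c) A) 1
    (memory r v true a (15 + o) j m.+1 c (m.+1 - c) A).
  by apply: runs_block => /=; split=> //; lia.
have cE : (m.+1 - c == 0) = (m < c) by lia.
have [hc|hc] := boolP (m < c).
  exists c, (m.+1 - c), A; split; last first.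
    move=> i; rewrite andbT; case: eqP => //= ->; case: f {h1 h2 h4 h5} => //.
    by rewrite -/c; lia.
  rewrite orbT; apply: (runs_leq (t := 4 + (2 + (1 + 2) + 2 + 2))); last by [].
  apply: runs_seq h1 (runs_seq (runs_if _) (h3 _ _ _ _)).
  rewrite /= x0E hitE; apply: runs_seq h2 (runs_if _).
  by rewrite /= cE hc.
rewrite andbF orbF.
case: f h1 h2 h4 h5 => h1 h2 h4 _.
  exists c, (m.+1 - c), A'; split; last first.
    move=> i; rewrite /= andbT nth_set_nth /=; case: eqP => // _.
    by rewrite -/c; lia.
  apply: (runs_leq (t := 4 + (2 + (1 + 2 + 2) + 2 + 2))); last by [].
  apply: runs_seq h1 (runs_seq (runs_if _) (h3 _ _ _ _)).
  rewrite /= x0E hitE; apply: runs_seq h2 (runs_if _).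
  by rewrite /= cE (negbTE hc); apply: runs_if.
exists c, (m.+1 - c), A; split; last by move=> i; rewrite /= andbF.
apply: (runs_leq (t := 4 + (2 + (0 + 2 + 2) + 2 + 2))); last by [].
apply: runs_seq h1 (runs_seq (runs_if _) (h3 _ _ _ _)).
rewrite /= x0E hitE; apply: runs_seq h2 (runs_if _).
rewrite /= cE (negbTE hc); apply: runs_if.
by apply: runs_block.
Qed.

(** Since [l] has no repetition, a hit that raises the flag is not followed by another one on the
    same path; hence the cell depends on the initial [f] alone. *)
Lemma run_walk r v (f : bool) a o j l x0 y0 A :
  v < n -> o < k -> segment input a l -> uniq l -> size l <= n ->
  all (fun u => u < n) l ->
  exists x y A',
  [/\ runs (While rM visit) (memory r v f a (15 + o) j (size l) x0 y0 A)
        (17 * size l + 1)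
        (memory r v (f || (0 < rest v l <= cell A o)) (a + size l) (15 + o) j 0
           x y A')
    & forall i, cell A' i =
        if (i == o) && f then maxn (cell A o) (rest v l) else cell A i].
Proof.
move=> hv ho.
elim: l f a x0 y0 A => [|u l IH] f a x0 y0 A hs hu hsz hall.
  exists x0, y0, A; split; last first.
    by move=> i; rewrite /rest /= maxn0; case: ifP => // /andP[/eqP->].
  by rewrite orbF addn0; apply: runs_while0.
have := segment_size hs; rewrite /= => hsize.
have [eu hs'] := segment_cons 0 hs.
move: hu hall => /= /andP[hul hu] /andP[hun hall].
have [||||x1 [y1 [A1 [r1 A1E]]]] := @run_visit r v f a o j (size l) x0 y0 A hv.
- by rewrite eu.
- by lia.
- by lia.
- by lia.
set f1 := f || _ in r1; rewrite eu in A1E.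
have [|x2 [y2 [A2 [r2 A2E]]]] := IH f1 a.+1 x1 y1 A1 hs' hu _ hall.
  by move: hsz => /=; lia.
exists x2, y2, A2; split.
  rewrite (_ : a + size (u :: l) = a.+1 + size l); last by rewrite addSnnS.
  apply: (runs_leq (t := 15 + (17 * size l + 1) + 2)); last by lia.
  apply: runs_whileS r1 _ => //; move: r2.
  suff -> : f1 || (0 < rest v l <= cell A1 o)
      = f || (0 < rest v (u :: l) <= cell A o) by [].
  rewrite /f1 eu A1E rest_cons; case: (u =P v) => [uv|_]; last by rewrite !andbF orbF.
  by rewrite -uv rest_notin // orbF.
move=> i; rewrite A2E !A1E /f1 eu rest_cons eqxx /=.
case: (u =P v) => [uv|_]; last by rewrite !andbF orbF.
rewrite -uv rest_notin // maxn0; case: eqP => [->|_] //=; rewrite ?eqxx /=.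
by case: f {r1 r2 f1 A1E A2E} => //=; case: ifP.
Qed.

(** Stated for the paths from index [o] on, to allow induction; leaving the cells below [o]
    untouched preserves what was done for earlier paths. *)
Lemma run_scan_paths r v (f : bool) a o ps m0 x0 y0 A :
  v < n -> o + size ps <= k ->
  segment input a (flatten [seq size l :: l | l <- ps]) ->
  (forall l : seq nat, l \in ps -> [/\ uniq l, size l <= n & all (fun u => u < n) l]) ->
  exists a' p m x y (f' : bool) A',
  [/\ runs (While rJ scan_path) (memory r v f a (15 + o) (size ps) m0 x0 y0 A)
        ((17 * n + 7) * size ps + 1)
        (memory r v f' a' p 0 m x y A'),
      forall i, i < o -> cell A' i = cell A i
    & scanned v ps f (fun i => cell A (o + i)) f' (fun i => cell A' (o + i))].
Proof.
move=> hv.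
elim: ps f a o m0 x0 y0 A => [|l ps IH] f a o m0 x0 y0 A ho hs hgood.
  exists a, (15 + o), m0, x0, y0, f, A; split=> //.
    by rewrite muln0; apply: runs_while0.
  split=> //.
  - by split=> [|[]] //; [left|case=> i; rewrite nth_nil].
  - by move=> i; rewrite nth_nil maxn0 leqnn.
  - by move=> _ i; rewrite nth_nil.
have := segment_size hs; rewrite /= size_cat => hsize.
move: hs => /= /(segment_cons 0)[em /segment_cat[hsl hs]].
have [hul hszl hall] := hgood l (mem_head _ _).
move: ho => /= ho.
have hok : o < k by lia.
have [x1 [y1 [A1 [r1 A1E]]]] := @run_walk r v f a.+1 o (size ps).+1 l x0 y0 A
  hv hok hsl hul hszl hall.
set f1 := f || _ in r1.
have [||a' [p [m [x2 [y2 [f' [A2 [r2 A2E sc]]]]]]]] :=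
  IH f1 (a.+1 + size l) o.+1 0 x1 y1 A1 _ hs.
- by lia.
- by move=> l' hl'; apply: hgood; rewrite inE hl' orbT.
exists a', p, m, x2, y2, f', A2; split.
- have r0 : runs (Block [:: IRead rM rA; IAdd rA rA rOne])
      (memory r v f a (15 + o) (size ps).+1 m0 x0 y0 A) 2
      (memory r v f a.+1 (15 + o) (size ps).+1 (size l) x0 y0 A).
    have := @runs_block input (15 + k) V [:: IRead rM rA; IAdd rA rA rOne]
      (memory r v f a (15 + o) (size ps).+1 m0 x0 y0 A).
    by rewrite /= /perform /= em addn1; apply; lia.
  have r3 : runs (Block [:: IAdd rP rP rOne; ISub rJ rJ rOne])
      (memory r v f1 (a.+1 + size l) (15 + o) (size ps).+1 0 x1 y1 A1) 2
      (memory r v f1 (a.+1 + size l) (15 + o.+1) (size ps) 0 x1 y1 A1).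
    have := @runs_block input (15 + k) V [:: IAdd rP rP rOne; ISub rJ rJ rOne]
      (memory r v f1 (a.+1 + size l) (15 + o) (size ps).+1 0 x1 y1 A1).
    by rewrite /= /perform /= addn1 subn1 -addnS; apply; lia.
  apply: (runs_leq (t := 2 + (17 * size l + 1 + 2) +
    ((17 * n + 7) * size ps + 1) + 2)); last by rewrite /= mulnS; lia.
  apply: runs_whileS r2 => //.
  exact: runs_seq r0 (runs_seq r1 r3).
- move=> i hi; rewrite A2E ?A1E; last by lia.
  by rewrite (ltn_eqF hi).
case: sc => sc1 sc2 sc3 sc4.
have A1S i : cell A1 (o.+1 + i) = cell A (o + i.+1).
  by rewrite A1E addSnnS gtn_eqF //; lia.
have A2o : cell A2 o = cell A1 o by apply: A2E.
split.
- rewrite sc1 /f1; split.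
    case=> [/orP[hf|h0]|[i hi]]; first by left.
      by right; exists 0; rewrite addn0.
    by right; exists i.+1; rewrite -A1S.
  case=> [->|[[|i] hi]]; first by left.
    by left; rewrite /= addn0 in hi; rewrite hi orbT.
  by right; exists i; rewrite A1S.
- case=> [|i]; last by have := sc2 i; rewrite A1S addSnnS.
  rewrite /= addn0 A2o A1E eqxx /=; case: ifP => _; lia.
- move=> hf; have hf1 : f1 by rewrite /f1 hf.
  case=> [|i]; last by have := sc3 hf1 i; rewrite addSnnS.
  by rewrite /= addn0 A2o A1E eqxx hf /= leq_maxr.
move=> hf' i.
have hf1 : ~~ f1 by apply: contra hf' => h; apply/sc1; left.
have hf : ~~ f by apply: contra hf1; rewrite /f1 => ->.
case: i => [|i]; last by have := sc4 hf' i; rewrite A1S addSnnS.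
by rewrite addn0 A2o A1E eqxx (negbTE hf).
Qed.

Lemma run_scan r v (f : bool) a p j m x y A :
  v < n ->
  exists a' p' m' x' y' (f' : bool) A',
  runs scan (memory r v f a p j m x y A) ((17 * n + 7) * k + 4)
    (memory r v f' a' p' 0 m' x' y' A')
  /\ scanned v Q f (nth 0 A) f' (nth 0 A').
Proof.
move=> hv.
have [||a' [p' [m' [x' [y' [f' [A' [r1 _ sc]]]]]]]] :=
  @run_scan_paths r v f b 0 Q m x y A hv _ input_paths.
- by rewrite size_Q.
- exact: good_paths.
exists a', p', m', x', y', f', A'; split=> //.
have hb : b <= V by have := segment_size input_paths; lia.
apply: (runs_leq (t := 3 + ((17 * n + 7) * size Q + 1))); last by rewrite size_Q; lia.
apply: runs_seq r1; rewrite size_Q addn0.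
by apply: runs_block => /=; lia.
Qed.

Definition known (v : nat) (A : seq nat) : Prop :=
  v = s \/ exists i, 0 < rest v (path_at i) <= cell A i.

Lemma run_query r v (f : bool) a p j m x y A :
  v < n ->
  exists a' p' m' x' y' (f' : bool) A',
  [/\ runs query (memory r v f a p j m x y A) ((17 * n + 7) * k + 8)
        (memory r v f' a' p' 0 m' x' y' A'),
      f' <-> known v A,
      forall i, cell A i <= cell A' i <= maxn (cell A i) (rest v (path_at i))
    & ~~ f' -> forall i, cell A' i = cell A i].
Proof.
move=> hv.
pose x0 := v - s + (s - v).
have [a' [p' [m' [x' [y' [f' [A' [r1 [sc1 sc2 sc3 sc4]]]]]]]]] :=
  @run_scan r v (v == s) a p j m x0 (s - v) A hv.
exists a', p', m', x', y', f', A'; split=> //.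
  apply: (runs_leq (t := 4 + ((17 * n + 7) * k + 4))); last by lia.
  apply: runs_seq r1.
  have -> : nat_of_bool (v == s) = 1 - x0 by rewrite /x0; lia.
  by apply: runs_block => /=; lia.
by rewrite sc1; split=> [[/eqP|]|[/eqP|]]; [left|right|left|right].
Qed.

(** The second clause yields progress; the first and third yield soundness. *)
Definition relaxed (v : nat) (A A' : seq nat) : Prop :=
  [/\ forall i, cell A i <= cell A' i <= maxn (cell A i) (rest v (path_at i)),
      known v A -> forall i, rest v (path_at i) <= cell A' i
    & known v A \/ forall i, cell A' i = cell A i].

Lemma known_mono v A A' :
  (forall i, cell A i <= cell A' i) -> known v A -> known v A'.
Proof.
move=> h [|[i hi]]; [by left|right; exists i].
by have := h i; lia.
Qed.

Lemma run_relax r v (f : bool) a p j m x y A :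
  v < n ->
  exists a' p' m' x' y' (f' : bool) A',
  runs relax (memory r v.+1 f a p j m x y A) ((17 * n + 7) * k * 2 + 13)
    (memory r v f' a' p' 0 m' x' y' A')
  /\ relaxed v A A'.
Proof.
move=> hv.
have [a1 [p1 [m1 [x1 [y1 [f1 [A1 [r1 q1 q2 q3]]]]]]]] :=
  @run_query r v f a p j m x y A hv.
have [a2 [p2 [m2 [x2 [y2 [f2 [A2 [r2 [s1 s2 s3 s4]]]]]]]]] :=
  @run_scan r v f1 a1 p1 0 m1 x1 y1 A1 hv.
exists a2, p2, m2, x2, y2, f2, A2; split.
  apply: (runs_leq (t := 1 + ((17 * n + 7) * k + 8 + ((17 * n + 7) * k + 4)))).
    apply: runs_seq (runs_seq r1 r2).
    have := @runs_block input (15 + k) V [:: ISub rV rV rOne]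
      (memory r v.+1 f a p j m x y A).
    by rewrite /= /perform /= subn1; apply; lia.
  by lia.
split=> [i|/q1|].
- by have := q2 i; have := s2 i; rewrite -/(path_at i); lia.
- exact: s3.
(* If the query leaves the flag unset, it has changed no cell, so the second scan meets the same
   suffixes and cannot set the flag either. *)
have [/q1 kv|nf1] := boolP f1; [by left|right=> i].
rewrite -q3 // s4 //; apply/negP => /s1[h|[i' hi']].
  by rewrite h in nf1.
by case/negP: (nf1); apply/q1; right; exists i'; rewrite -q3.
Qed.

(** * Soundness, for any property of vertices that holds at [s] and propagates forward along
    paths *)

Variable Rch : nat -> Prop.
Hypothesis Rch_s : Rch s.
Hypothesis Rch_path :
  forall i u v, Rch u -> 0 < rest v (path_at i) <= rest u (path_at i) -> Rch v.

Definition sound (A : seq nat) : Prop :=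
  forall i v, 0 < rest v (path_at i) <= cell A i -> Rch v.

Lemma known_sound v A : sound A -> known v A -> Rch v.
Proof. by move=> h [-> //|[i]]; apply: h. Qed.

Lemma relaxed_sound v A A' : relaxed v A A' -> sound A -> sound A'.
Proof.
move=> [h1 h2 h3] hA i u hu.
have [hle|hlt] := leqP (cell A' i) (cell A i); first by apply: (hA i); lia.
(* A vertex newly covered on path [i] lies at or after [v] there, and [v] was known. *)
apply: (@Rch_path i v); last by have := h1 i; lia.
case: h3 => [|h3]; first exact: known_sound.
by move: hlt; rewrite h3 ltnn.
Qed.

(** Vertices are relaxed from [w - 1] down to 0. Cells never decrease, so a vertex known at the
    start is still known at its turn, and its effect persists. *)
Lemma run_relax_all r w (f : bool) a p j m x y A :
  w <= n ->
  exists a' p' j' m' x' y' (f' : bool) A',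
  [/\ runs (While rV relax) (memory r w f a p j m x y A)
        (((17 * n + 7) * k * 2 + 15) * w + 1)
        (memory r 0 f' a' p' j' m' x' y' A'),
      forall i, cell A i <= cell A' i,
      sound A -> sound A'
    & forall v, v < w -> known v A -> forall i, rest v (path_at i) <= cell A' i].
Proof.
elim: w f a p j m x y A => [|w IH] f a p j m x y A hw.
  exists a, p, j, m, x, y, f, A; split=> //.
  by rewrite muln0; apply: runs_while0.
have [a1 [p1 [m1 [x1 [y1 [f1 [A1 [r1 rel]]]]]]]] :=
  @run_relax r w f a p j m x y A hw.
have [a2 [p2 [j2 [m2 [x2 [y2 [f2 [A2 [r2 mono2 snd2 cov2]]]]]]]]] :=
  IH f1 a1 p1 0 m1 x1 y1 A1 (ltnW hw).
have [rel1 rel2 _] := rel.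
have mono1 i : cell A i <= cell A1 i by have := rel1 i; lia.
exists a2, p2, j2, m2, x2, y2, f2, A2; split.
- apply: (runs_leq (t := (17 * n + 7) * k * 2 + 13 +
    (((17 * n + 7) * k * 2 + 15) * w + 1) + 2)); last by rewrite mulnS; lia.
  exact: runs_whileS r1 r2.
- by move=> i; apply: leq_trans (mono2 i).
- by move=> /(relaxed_sound rel)/snd2.
move=> v; rewrite ltnS leq_eqVlt => /orP[/eqP->|hv] kv i.
  exact: leq_trans (rel2 kv i) (mono2 i).
by apply: cov2 => //; apply: known_mono kv.
Qed.

(** * Completeness by rounds *)

(** A journey of exactly [d] moves from [s], each going any distance forward, possibly none, along
    one path. *)
Fixpoint near (d v : nat) : Prop :=
  if d is d'.+1 then
    exists u i, [/\ near d' u, u < n & 0 < rest v (path_at i) <= rest u (path_at i)]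
  else v = s.

Definition covers (d : nat) (A : seq nat) : Prop :=
  forall d' v, d' <= d -> near d' v -> known v A.

Lemma run_rounds d r v (f : bool) a p j m x y A :
  r <= n -> covers d A ->
  exists v' a' p' j' m' x' y' (f' : bool) A',
  [/\ runs (While rRound round) (memory r v f a p j m x y A)
        ((((17 * n + 7) * k * 2 + 15) * n + 5) * r + 1)
        (memory 0 v' f' a' p' j' m' x' y' A'),
      sound A -> sound A'
    & covers (d + r) A'].
Proof.
elim: r d v f a p j m x y A => [|r IH] d v f a p j m x y A hr cov.
  exists v, a, p, j, m, x, y, f, A; split=> //; last by rewrite addn0.
  by rewrite muln0; apply: runs_while0.
have [a1 [p1 [j1 [m1 [x1 [y1 [f1 [A1 [r1 mono1 snd1 cov1]]]]]]]]] :=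
  @run_relax_all r.+1 n f a p j m x y A (leqnn n).
(* The last move starts at a vertex [u] already known; relaxing [u] extended the suffix of path [i]
   to [u], hence past the end point of the move. *)
have cov' : covers d.+1 A1.
  move=> [|d'] w hd'; first by left.
  case=> u [i [hu hun hw]]; right; exists i.
  by have := cov1 u hun (cov _ _ hd' hu) i; lia.
have [v2 [a2 [p2 [j2 [m2 [x2 [y2 [f2 [A2 [r2 snd2 cov2]]]]]]]]]] :=
  IH d.+1 0 f1 a1 p1 j1 m1 x1 y1 A1 (ltnW hr) cov'.
exists v2, a2, p2, j2, m2, x2, y2, f2, A2; split.
- apply: (runs_leq (t := (1 + (((17 * n + 7) * k * 2 + 15) * n + 1 + 1)) +
    ((((17 * n + 7) * k * 2 + 15) * n + 5) * r + 1) + 2)); last by rewrite mulnS; lia.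
  apply: runs_whileS r2 => //; apply: runs_seq (runs_seq r1 _).
    by apply: runs_block => /=; lia.
  have := @runs_block input (15 + k) V [:: ISub rRound rRound rOne]
    (memory r.+1 0 f1 a1 p1 j1 m1 x1 y1 A1).
  by rewrite /= /perform /= subn1; apply; lia.
- by move=> /snd1/snd2.
by rewrite addnS -addSn.
Qed.

(** * The complete run *)

(** Memory while the matrix is skipped; the 3 is the last input address that the prologue put in
    [rX]. *)
Let start c r := [:: n; s; t; k; c; 1; r; 0; 0; 0; 0; 0; 0; 3; 0].

Lemma run_base c r :
  r <= n -> c + r * n <= V ->
  runs (While rRound skip_row) (start c r) (4 * r + 1) (start (c + r * n) 0).
Proof.
elim: r c => [|r IH] c hr hV.
  by rewrite mul0n addn0 muln0; apply: runs_while0.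
apply: (runs_leq (t := 2 + (4 * r + 1) + 2)); last by lia.
rewrite mulSn in hV *.
rewrite (_ : c + _ = c + n + r * n); last by lia.
apply: runs_whileS (IH _ _ _) => //; try lia.
have := @runs_block input (15 + k) V [:: IAdd rBase rBase rN; ISub rRound rRound rOne]
  (start c r.+1).
by rewrite /= /perform /= subn1; apply; lia.
Qed.

Lemma run_decide :
  exists mem (answer : bool),
  [/\ runs decide [::] ((((17 * n + 7) * k * 2 + 15) * n + 5) * n +
         (17 * n + 7) * k + 4 * n + 22) mem,
      nth 0 mem rF = answer,
      answer -> Rch t
    & forall d, d <= n -> near d t -> answer].
Proof.
have hb : b <= V by have := segment_size input_paths; lia.
have [i0 i1 i2 i3] := input_header.
have r1 : runs (Block prologue) [::] 10 (start 4 n).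
  have := @runs_block input (15 + k) V prologue [::].
  by rewrite /= /perform /= i0 i1 i2 i3; apply; lia.
have r2 := @run_base 4 n (leqnn n) hb.
have r3 : runs (Block [:: ICopy rRound rN]) (start b 0) 1
    (memory n 0 false 0 0 0 0 3 0 [::]).
  by apply: runs_block => /=; lia.
have cov : covers 0 [::] by move=> [|//] v _; left.
have [v4 [a4 [p4 [j4 [m4 [x4 [y4 [f4 [A4 [r4 snd4 cov4]]]]]]]]]] :=
  @run_rounds 0 n 0 false 0 0 0 0 3 0 [::] (leqnn n) cov.
have [a5 [p5 [m5 [x5 [y5 [f5 [A5 [r5 q1 _ _]]]]]]]] :=
  @run_query 0 t f4 a4 p4 j4 m4 x4 y4 A4 lt_tn.
exists (memory 0 t f5 a5 p5 0 m5 x5 y5 A5), f5; split=> //.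
- apply: (runs_leq (t := 10 + ((4 * n + 1) + (1 +
   ((((17 * n + 7) * k * 2 + 15) * n + 5) * n + 1 + (1 + ((17 * n + 7) * k + 8))))))).
    apply: runs_seq r1 (runs_seq r2 (runs_seq r3 (runs_seq r4 (runs_seq _ r5)))).
    by apply: runs_block => /=; lia.
  by lia.
(* Before the rounds no path cell is allocated: all suffixes are empty and [sound] holds
   vacuously. *)
- move=> /q1; apply: known_sound; apply: snd4 => i v.
  by rewrite nth_nil; lia.
by move=> d hd hn; apply/q1; apply: (cov4 d).
Qed.

End Reach.

(** * From the final flag to a halting answer *)

Lemma decide_program input lim V T m (answer : bool) :
  runs input lim V decide [::] T m -> nth 0 m rF = answer ->
  decides_within reach_program input answer T.+1 (lim * bitlen V).
Proof.
move=> h hf.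
have hs : segment reach_program 0 (compile 0 decide).
  by exists [::], [:: IJumpZ rF (clen decide).+2; IHalt true; IHalt false].
have [|i [hi ei ht]] := h reach_program 0 hs; first by [].
have e : run reach_program input i.+1 =
    Config (if answer then (clen decide).+1 else (clen decide).+2) m.
  rewrite /run iterS ei /step /fetch.
  have -> : nth (IHalt false) reach_program (0 + clen decide) =
    IJumpZ rF (clen decide).+2 by [].
  by rewrite /= hf; case: (answer).
exists i.+1; split=> //; first by rewrite e; case: (answer).
move=> j; rewrite leq_eqVlt ltnS => /orP[/eqP->|hj].
  by rewrite e; have := ht i (leqnn i); rewrite ei; apply: tame_space.
by apply: tame_space (ht j hj).
Qed.

(** * Path decompositions and reachability *)

Section Graph.
Variables (n : nat) (e : rel 'I_n) (s t : 'I_n) (P : seq (seq 'I_n)).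
Hypothesis (e_irr : irreflexive e) (P_dec : path_decomposition e P).

Let Q : seq (seq nat) := [seq map val p | p <- P].

Lemma rest_val (v : 'I_n) (p : seq 'I_n) :
  rest (val v) (map val p) = size p - index v p.
Proof. by rewrite /rest size_map index_map //; apply: val_inj. Qed.

Lemma nth_Q i v : 0 < rest v (nth [::] Q i) ->
  exists2 p, p \in P & nth [::] Q i = map val p.
Proof.
have [hi|hi] := ltnP i (size P); last by rewrite nth_default ?size_map.
by exists (nth [::] P i); rewrite ?mem_nth //; apply: nth_map.
Qed.

Lemma connect_nth (p : seq 'I_n) x0 i j :
  simple_dipath e p -> i <= j < size p -> connect e (nth x0 p i) (nth x0 p j).
Proof.
case: p => // x q /andP[/(pathP x0) hq _] /andP[+ hj].
elim: j hj => [|j IH] hj; first by rewrite leqn0 => /eqP->.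
rewrite leq_eqVlt ltnS => /orP[/eqP->//|hij].
by apply: connect_trans (IH (ltnW hj) hij) (connect1 (hq _ hj)).
Qed.

(** [rest] decreases along a path, so the inequality places [v] at or after [u]; this is the
    propagation property used for soundness. *)
Lemma connect_rest i u v :
  (exists2 w : 'I_n, val w = u & connect e s w) ->
  0 < rest v (nth [::] Q i) <= rest u (nth [::] Q i) ->
  exists2 w : 'I_n, val w = v & connect e s w.
Proof.
move=> [w <- sw] /andP[h0]; have [p hp ep] := nth_Q h0; rewrite ep in h0 *.
have /mapP[w' hw' ew'] : v \in map val p.
  by apply/negPn/negP => /rest_notin; lia.
rewrite ew' in h0 *; rewrite !rest_val => hle; exists w' => //.
have hlt : index w' p < size p by rewrite index_mem.
have hle' : index w p <= index w' p.
  by rewrite leq_sub2lE ?index_size in hle.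
have hw : w \in p by rewrite -index_mem; apply: leq_ltn_trans hlt.
have [_ /allP hall _] := P_dec; apply: connect_trans sw _.
have := @connect_nth p w (index w p) (index w' p) (hall p hp).
by rewrite !nth_index //; apply; apply/andP.
Qed.

(** The arc sits at positions [j] and [j.+1] of some path; as vertices do not repeat, [index]
    returns these positions. *)
Lemma arc_rest u v : e u v ->
  exists i, 0 < rest (val v) (nth [::] Q i) <= rest (val u) (nth [::] Q i).
Proof.
have [_ /allP hall hcount] := P_dec; move=> huv.
have /hasP[p hp harc] : has (fun p => (u, v) \in arcs p) P.
  by rewrite has_count hcount.
exists (index p P); rewrite (nth_map [::]) ?index_mem // nth_index //.
rewrite !rest_val; have := hall _ hp; case: p harc {hp} => // x q harc /andP[_ hu].
have [j hj ej] : exists2 j, j < size q & (u, v) = nth (u, u) (arcs (x :: q)) j.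
  exists (index (u, v) (arcs (x :: q))); last by rewrite nth_index.
  by move: harc; rewrite -index_mem size2_zip.
move: ej; rewrite nth_zip_cond size2_zip // hj => -[eu ev].
have -> : index u (x :: q) = j by rewrite {1}eu index_uniq //= ltnW.
have -> : index v (x :: q) = j.+1.
  by rewrite {1}ev -[nth u _ j]/(nth u (x :: q) j.+1) index_uniq.
by rewrite /= subSS subn_gt0 hj leq_sub2r.
Qed.

(** A walk shortened to a simple path has at most [n] vertices, and each of its arcs is one move
    along a path of the decomposition. *)
Lemma near_connect : connect e s t ->
  exists2 d, d <= n & near n (val s) Q d (val t).
Proof.
case/connectP => q0 /shortenP[q hq hu _] ->; exists (size q).
  have := max_card (mem (s :: q)); rewrite card_ord (card_uniqP hu).
  exact: ltnW.
elim/last_ind: q hq {hu} => // q v IH; rewrite rcons_path size_rcons last_rcons.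
case/andP => /IH hn /arc_rest[i hi] /=.
by exists (val (last s q)), i; split=> //; apply: ltn_ord.
Qed.

(* Injectivity of the map to the first arc, a path with one vertex [x] being sent
   to [(x, x)], which is not an arc. *)
Lemma size_decomposition : size P <= n * n.
Proof.
have [hu /allP hall hcount] := P_dec.
pose f (p : seq 'I_n) := if p is x :: q then (x, head x q) else (s, s).
suff h : uniq (map f P).
  by rewrite -(size_map f) -(card_uniqP h) -[n in leqRHS]card_ord -card_prod max_card.
rewrite map_inj_in_uniq // => -[|x p] [|y q] hp hq //=; try by
  [have := hall _ hp | have := hall _ hq].
have := hall _ hq; have := hall _ hp.
case: p hp => [|x' p] hp; case: q hq => [|y' q] hq /=.
- by move=> _ _ [->].
- by move=> _ /andP[/andP[hy _] _] [ex ey]; move: hy; rewrite -ex -ey e_irr.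
- by move=> /andP[/andP[hy _] _] _ [ex ey]; move: hy; rewrite ey ex e_irr.
move=> /andP[/andP[hx _] _] _ [exy exy']; apply/eqP/negPn/negP => hne.
have := hcount _ _ hx; rewrite -size_filter => hsz.
have hmem r : r \in P -> (x, x') \in arcs r ->
    r \in [seq p <- P | (x, x') \in arcs p] by rewrite mem_filter => -> ->.
have := hmem _ hp (mem_head _ _).
have := hmem (y :: y' :: q) hq; rewrite -exy -exy' => /(_ (mem_head _ _)).
case: [seq _ <- _ | _] hsz => [|z [|]] // _; rewrite !inE => /eqP<- /eqP hh.
by move: hne; rewrite hh exy exy' eqxx.
Qed.

End Graph.

(** * Size estimates and the final bounds *)

Lemma size_path_data n (Q : seq (seq nat)) :
  (forall l : seq nat, l \in Q -> size l <= n) ->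
  size (flatten [seq size l :: l | l <- Q]) <= n.+1 * size Q.
Proof.
elim: Q => [|l Q IH] h //=; rewrite size_cat mulnS -addSn leq_add //.
  by rewrite ltnS h ?mem_head.
by apply: IH => l' hl'; rewrite h // inE hl' orbT.
Qed.

(** With [n < 2 ^ L.+1] the value is below [2 ^ (3 * L + 8)], and [3 * L + 8] is at most 11 times
    the maximum of 1 and [L]. *)
Lemma bitlen_cubic n V : 0 < n -> V <= 2 ^ 5 * n ^ 3 ->
  bitlen V <= 11 * maxn 1 (trunc_log 2 n).
Proof.
move=> n_gt0 hV; set L := trunc_log 2 n.
have hn : n < 2 ^ L.+1 by apply: trunc_log_ltn.
suff : bitlen V <= 3 * L + 8 by lia.
have [->|V_gt0] := posnP V; first by rewrite /bitlen trunc_log0; lia.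
rewrite /bitlen -(@ltn_exp2l 2) //; apply: leq_ltn_trans (trunc_logP _ V_gt0) _ => //.
apply: leq_ltn_trans hV _.
rewrite (_ : 3 * L + 8 = 5 + L.+1 * 3); last by lia.
by rewrite expnD expnM ltn_pmul2l // ltn_exp2r.
Qed.

Theorem theorem1 :
  exists (prog : program) (c a d : nat),
    forall (n : nat) (e : rel 'I_n) (s t : 'I_n) (P : seq (seq 'I_n)),
      irreflexive e ->
      path_decomposition e P ->
      decides_within prog (encode e s t P) (connect e s t)
        (a * n ^ d) (c * klogn (size P) n).
Proof.
(* 176 is 16 * 11: at most [16 * maxn 1 k] cells, each of at most [11 * maxn 1 (trunc_log 2 n)]
   bits. 119 is 48 + 15 + 9 + 24 + 23, the coefficients of the running time after each term is
   bounded by a multiple of [n ^ 5]. *)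
exists reach_program, 176, 119, 5 => n e s t P e_irr P_dec.
pose Q : seq (seq nat) := [seq map val p | p <- P].
set input := encode e s t P; set k := size P.
(* One bound for vertices, memory addresses and input addresses; it is cubic in [n] because
   [k <= n * n]. *)
pose V := 15 + n + k + size input.
have n_gt0 : 0 < n by apply: leq_ltn_trans (ltn_ord s).
have [P_uniq /allP P_paths _] := P_dec.
have le_kn : k <= n * n := size_decomposition s e_irr P_dec.
have good l : l \in Q -> [/\ uniq l, size l <= n & all (fun u => u < n) l].
  case/mapP => p /P_paths hp ->; have hu : uniq p by case: p hp => // x q /andP[].
  split; first by rewrite map_inj_uniq //; apply: val_inj.
    by have := max_card (mem p); rewrite card_ord (card_uniqP hu) size_map.
  by apply/allP => u /mapP[w _ ->]; apply: ltn_ord.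
pose data := flatten [seq size l :: l | l <- Q].
pose header := [:: n; val s; val t; k] ++
  [seq nat_of_bool (e u v) | u <- enum 'I_n, v <- enum 'I_n].
have inputE : input = header ++ data.
  rewrite /input /encode /header -catA; congr (_ ++ (_ ++ flatten _)).
  by rewrite -map_comp; apply: eq_map => p /=; rewrite size_map.
have size_header : size header = 4 + n * n.
  by rewrite size_cat size_allpairs size_enum_ord.
have seg : segment input (4 + n * n) data.
  by exists header, [::]; rewrite cats0.
have sQ : size Q = k by rewrite size_map.
have size_data : size data <= n.+1 * k.
  by rewrite -sQ; apply: size_path_data => l /good[].
have size_input : size input <= 4 + n * n + n.+1 * k.
  by rewrite inputE size_cat size_header leq_add2l.
have rest_path i u v := @connect_rest n e s P P_dec i u v.
have [|||||m [answer [r f_ans s_ans c_ans]]] :=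
  @run_decide input n s t k V Q sQ _ seg good (ltn_ord s) (ltn_ord t) _ _ _
    (fun v => exists2 w : 'I_n, val w = v & connect e s w) _ rest_path.
- by [].
- by rewrite /V; lia.
- by rewrite /V; lia.
- by rewrite /V; lia.
- by exists s.
have -> : connect e s t = answer.
  apply/idP/idP => [/(near_connect P_dec)[d]|/s_ans[w /val_inj -> //]].
  exact: c_ans.
have [i [hi ht hs]] := decide_program r f_ans.
exists i; split=> //.
  apply: leq_trans hi _.
  set w := (17 * n + 7) * k.
  (* Here [17 * n + 7 <= 24 * n], as [n] is positive. *)
  have hw : w <= 24 * n ^ 3.
    apply: (@leq_trans (24 * n * (n * n))); last by rewrite !expnS expn0; lia.
    by apply: leq_mul => //; lia.
  have hwn : w * (n * n) <= 24 * n ^ 5.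
    by rewrite (expnD n 3 2) (mulnA 24) -mulnn; apply: leq_mul.
  have pow j : j <= 5 -> n ^ j <= n ^ 5 by move=> hj; rewrite leq_pexp2l.
  have := pow 0 isT; have := pow 1 isT; have := pow 2 isT; have := pow 3 isT.
  rewrite -(mulnn n) expn0 expn1; lia.
move=> j hj; apply: leq_trans (hs j hj) _.
rewrite -[176]/(16 * 11) /klogn mulnACA; apply: leq_mul; first by lia.
apply: bitlen_cubic => //; rewrite /V.
have hnk : n * k <= n * (n * n) by rewrite leq_mul2l le_kn orbT.
have sq : n <= n * n by apply: leq_pmulr.
have cube : n * n <= n * (n * n) by apply: leq_pmull.
rewrite (expnS n 2) -mulnn; lia.
Qed.
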